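(* Consider an instance of $\texttt{SoftCumulative}$ with activity set $A$, current domains $D(\cdot)$, horizon $m$ and limits $ideal\_capa\le max\_capa$. Let $\langle[\delta,\delta'[,sum_h\rangle$ be a rectangle of the cumulated profile, with $0\le\delta<\delta'\le m$. For each $t\in[\delta,\delta'[$, if $$sum_h-ideal\_capa>\min(D(costVar[t])),$$ then all values in $[\min(D(costVar[t])),\ sum_h-ideal\_capa[$ can be removed from $D(costVar[t])$; that is, no solution of $\texttt{SoftCumulative}$ with respect to the current domains assigns to $costVar[t]$ a value in $[\min(D(costVar[t])),\ sum_h-ideal\_capa[$.
   Context: Time is discrete: points in time are integers, and $[x,y[$ denotes $\{t\in\mathbb{Z}: x\le t<y\}$. Each variable $x$ is integer-valued with a current finite nonempty domain $D(x)$, with minimum $\min(D(x))$ and maximum $\max(D(x))$. $A=\{a_1,\dots,a_n\}$ is a set of non-preemptive activities scheduled between time $0$ and $m$ (starts and ends lie in $\{0,\dots,m\}$). Each $a\in A$ has variables $start[a]$, $dur[a]$ (duration), $end[a]$ and $res[a]$ (amount of resource consumed, or height). Each activity consumes a positive amount of the resource (durations and heights are positive). For an assignment of the variables, the cumulated height at time $t$ is $h_t=\sum_{a\in A,\ start[a]\le t<end[a]}\min(D(res[a]))$. $\texttt{SoftCumulative}$ has two integer resource limits $ideal\_capa\le max\_capa$ and, for each point in time $t\in\{0,\dots,m-1\}$, an integer variable $costVar[t]$. It enforces: (C1) $start[a]+dur[a]=end[a]$ for every $a\in A$; (C2) $h_t\le max\_capa$ for every $t$; (C3) $costVar[t]=\max(0,h_t-ideal\_capa)$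 for every $t \in\{0,\dots,m-1\}$. A solution with respect to the current domains is an assignment of each variable to a value of its current domain satisfying C1, C2 and C3. A value $v$ ''can be removed'' from $D(x)$ if no solution assigns $v$ to $x$. The compulsory part of an activity $a$ is nonempty if and only if $\max(D(start[a]))<\min(D(end[a]))$, and then it has height $\min(D(res[a]))$ on $[\max(D(start[a])),\min(D(end[a]))[$ and height $0$ elsewhere. The cumulated profile is the function whose height at time $t$ is $\sum_{a\in A,\ t\in[\max(D(start[a])),\min(D(end[a]))[}\min(D(res[a]))$. A rectangle $\langle[\delta,\delta'[,sum_h\rangle$ of the profile is an interval $[\delta,\delta'[$ on which the set of activities whose compulsory part covers $t$ is the same for all $t$, with $sum_h$ the constant height of the profile on it. *)

(* Defs.v *)
From HB Require Import structures.
From mathcomp Require Import all_boot all_order all_algebra finmap.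

Set Implicit Arguments.
Unset Strict Implicit.
Unset Printing Implicit Defensive.

Import Order.TTheory GRing.Theory Num.Theory.
Local Open Scope fset_scope.
Local Open Scope ring_scope.

(* The neutral element [head 0 D] belongs to D when D is nonempty, so these are
   the least and greatest elements of D; both are 0 on the empty set. *)
Definition dmin (D : {fset int}) : int :=
  \big[Num.min/head 0 (enum_fset D)]_(v <- D) v.
Definition dmax (D : {fset int}) : int :=
  \big[Num.max/head 0 (enum_fset D)]_(v <- D) v.

Lemma head_in (D : {fset int}) : D != fset0 -> head 0 (enum_fset D) \in D.
Proof.
case/fset0Pn=> x xD.
suff H (u : seq int) : x \in u -> head 0 u \in u by exact: (H (enum_fset D) xD).
by case: u => //= y u _; rewrite mem_head.
Qed.

Lemma dmin_in (D : {fset int}) : D != fset0 -> dmin D \in D.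
Proof.
move=> D0; rewrite /dmin big_seq.
by elim/big_rec: _ => [|x y xD yD]; [exact: head_in | case: leP].
Qed.

Lemma dmax_in (D : {fset int}) : D != fset0 -> dmax D \in D.
Proof.
move=> D0; rewrite /dmax big_seq.
by elim/big_rec: _ => [|x y xD yD]; [exact: head_in | case: leP].
Qed.

Lemma dmin_le (D : {fset int}) (v : int) : v \in D -> dmin D <= v.
Proof.
rewrite -[v \in D]/(v \in enum_fset D) /dmin; move: (head _ _) => z.
elim: (enum_fset D) => //= x s IH; rewrite inE big_cons ge_min.
by case/predU1P=> [->|/IH ->]; rewrite ?lexx ?orbT.
Qed.

Lemma dmax_ge (D : {fset int}) (v : int) : v \in D -> v <= dmax D.
Proof.
rewrite -[v \in D]/(v \in enum_fset D) /dmax; move: (head _ _) => z.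
elim: (enum_fset D) => //= x s IH; rewrite inE big_cons le_max.
by case/predU1P=> [->|/IH ->]; rewrite ?lexx ?orbT.
Qed.

Inductive variable (A : finType) (m : nat) : Type :=
  | Start of A
  | Dur of A
  | End of A
  | Res of A
  | CostVar of 'I_m.
Arguments Start {A m}.
Arguments Dur {A m}.
Arguments End {A m}.
Arguments Res {A m}.
Arguments CostVar {A m}.

Record softCumulative (A : finType) (m : nat) := SoftCumulative {
  dom : variable A m -> {fset int};
  ideal_capa : int;
  max_capa : int;
  dom_neq0 : forall x, dom x != fset0;
  start_range : forall a v, v \in dom (Start a) -> 0 <= v <= m%:Z;
  end_range : forall a v, v \in dom (End a) -> 0 <= v <= m%:Z;
  dur_gt0 : forall a v, v \in dom (Dur a) -> 0 < v;
  res_gt0 : forall a v, v \in dom (Res a) -> 0 < v;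
  capa_le : ideal_capa <= max_capa
}.

Section SoftCumulativeDefs.
Variables (A : finType) (m : nat) (I : softCumulative A m).

Definition assignment := variable A m -> int.

(* Activities contribute the minimum of the domain of their height variable,
   not the value the assignment gives to that variable. *)
Definition height (s : assignment) (t : int) : int :=
  \sum_(a : A | s (Start a) <= t < s (End a)) dmin (dom I (Res a)).

Definition C1 (s : assignment) : Prop :=
  forall a : A, s (Start a) + s (Dur a) = s (End a).

Definition C2 (s : assignment) : Prop :=
  forall t : int, height s t <= max_capa I.

Definition C3 (s : assignment) : Prop :=
  forall t : 'I_m, s (CostVar t) = Num.max 0 (height s t%:Z - ideal_capa I).

Definition solution (s : assignment) : Prop :=
  [/\ forall x, s x \in dom I x, C1 s, C2 s & C3 s].

Definition can_be_removed (x : variable A m) (v : int) : Prop :=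
  forall s : assignment, solution s -> s x <> v.

(* The interval is empty, and covers no point, unless
   max(D(start[a])) < min(D(end[a])). *)
Definition compulsory_covers (a : A) (t : int) : bool :=
  t \in `[dmax (dom I (Start a)), dmin (dom I (End a))[.

Definition covering_set (t : int) : {set A} := [set a | compulsory_covers a t].

Definition profile (t : int) : int :=
  \sum_(a : A | compulsory_covers a t) dmin (dom I (Res a)).

Definition rectangle (delta delta' sum_h : int) : Prop :=
  (forall t t' : int, t \in `[delta, delta'[ -> t' \in `[delta, delta'[ ->
     covering_set t = covering_set t') /\
  (forall t : int, t \in `[delta, delta'[ -> profile t = sum_h).

End SoftCumulativeDefs.

(* Main.v *)
Require Import Defs.
From mathcomp Require Import all_boot all_order all_algebra finmap.
Import Order.TTheory GRing.Theory Num.Theory.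
Local Open Scope ring_scope.

(** Whatever values a solution picks, an activity runs throughout its compulsory part, so at each
    time the profile is a lower bound on the cumulated height. C3 then forces the cost at [t] to be
    at least [sum_h - ideal_capa I], which excludes every smaller value. *)

Lemma compulsory_covers_running (A : finType) (m : nat)
    (I : softCumulative A m) (s : assignment A m) (a : A) (t : int) :
  (forall x, s x \in dom I x) -> compulsory_covers I a t ->
  s (Start a) <= t < s (End a).
Proof.
move=> sD; rewrite /compulsory_covers in_itv /= => /andP[le_t lt_t].
by rewrite (le_trans (dmax_ge (sD (Start a))) le_t)
           (lt_le_trans lt_t (dmin_le (sD (End a)))).
Qed.

Lemma profile_le_height (A : finType) (m : nat) (I : softCumulative A m)
    (s : assignment A m) (t : int) :
  (forall x, s x \in dom I x) -> profile I t <= height I s t.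
Proof.
(* Both sums are extended by zeros to all of [A], to be compared term by term. *)
move=> sD; rewrite /profile /height big_mkcond [leRHS]big_mkcond /=.
apply: ler_sum => a _; case: ifP => [cov_a | _].
  by rewrite (compulsory_covers_running _ _ _ _ _ _ sD cov_a).
(* An activity running outside its compulsory part only adds height: its minimum height is a value
   of a domain of positive integers. *)
by case: ifP => // _; exact/ltW/res_gt0/dmin_in/dom_neq0.
Qed.

Theorem mainTheorem3 (A : finType) (m : nat) (I : softCumulative A m)
    (delta delta' sum_h : int)
    (hrect : rectangle I delta delta' sum_h)
    (h0 : 0 <= delta) (hlt : delta < delta') (hm : delta' <= m%:Z)
    (t : 'I_m) (ht : t%:Z \in `[delta, delta'[)
    (hcost : sum_h - ideal_capa I > dmin (dom I (CostVar t))) :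
  forall v : int,
    v \in `[dmin (dom I (CostVar t)), sum_h - ideal_capa I[ ->
    can_be_removed I (CostVar t) v.
Proof.
move=> v; rewrite in_itv /= => /andP[_ lt_v] s [sD _ _ costE] sv.
have [_ /(_ _ ht) profE] := hrect.
(* Only the second argument of the maximum matters: the profile bound contradicts [lt_v] through
   it. *)
move: lt_v; rewrite -sv costE ltNge le_max lerD2r -profE.
by rewrite profile_le_height ?orbT.
Qed.
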